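(* For all positive integers $d,r,k$ with $1\le r\le k\le d$, the sets $\mathcal{F}$ and $\mathcal{CR}1'$ (defined in the context, for these $d,r,k$) satisfy $$\mathrm{conv}(\mathcal{F})\;\subseteq\;\mathcal{CR}1'\;\subseteq\;\rho_{\mathcal{CR}1'}\cdot \mathrm{conv}(\mathcal{F}),$$ where $\rho_{\mathcal{CR}1'}=\sqrt{\tfrac{\pi}{2}}\cdot\left(2+\max\{6\sqrt{2\pi},\,12\sqrt{\log_2 (50r)}\}\right)$ (in particular $\rho_{\mathcal{CR}1'}=O(\sqrt{\log r})$).
   Context: All matrices are real. For $V\in\mathbb{R}^{d\times r}$, $V_{i,:}$ denotes the $i$-th row, and $\|V\|_0$ denotes the number of non-zero rows of $V$. $I^p$ is the $p\times p$ identity matrix, $\mathrm{diag}(h)$ is the diagonal matrix with diagonal $h$, $\succeq 0$ means positive semidefinite, $\mathrm{conv}$ is the convex hull, and $\rho\cdot S=\{\rho x: x\in S\}$. $\mathcal{F}=\{V\in\mathbb{R}^{d\times r}: V^\top V=I^r,\ \|V\|_0\le k\}$. $\mathcal{CR}1'$ is the set of all $V\in\mathbb{R}^{d\times r}$ for which there exists $h\in\mathbb{R}^d_+$ (entrywise nonnegative) such that $$\sum_{i=1}^d\|V_{i,:}\|_2\le\sqrt{rk},\qquad \sum_{i=1}^d h_i\le\frac{\pi}{2}k,\qquad \begin{bmatrix} I^d & V\\ V^\top & I^r\end{bmatrix}\succeq 0,\qquad \begin{bmatrix}\mathrm{diag}(h) & V\\ V^\top & I^r\end{bmatrix}\succeq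 0 .$$ *)

(* Defs.v *)
From HB Require Import structures.
From mathcomp Require Import all_boot all_order all_algebra.
From mathcomp Require Import all_classical all_reals all_analysis.

Set Implicit Arguments.
Unset Strict Implicit.
Unset Printing Implicit Defensive.

Import Order.TTheory GRing.Theory Num.Theory.
Import numFieldNormedType.Exports.

Local Open Scope classical_set_scope.
Local Open Scope ring_scope.

Definition convex_hull (R : realType) (M : lmodType R) (S : set M) : set M :=
  smallest (@convex_set R M) S.

Definition psdmx (R : realType) (n : nat) (A : 'M[R]_n) : Prop :=
  A \is symmetricmx /\ forall x : 'cV[R]_n, 0 <= (x^T *m A *m x) 0 0.

Definition row_norm2 (R : realType) (d r : nat) (V : 'M[R]_(d, r)) (i : 'I_d) : R :=
  Num.sqrt (\sum_(j < r) V i j ^+ 2).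

Definition nnz_rows (R : realType) (d r : nat) (V : 'M[R]_(d, r)) : nat :=
  #|[pred i | row i V != 0]|.

Definition sparse_orthonormal (R : realType) (d r k : nat) : set 'M[R]_(d, r) :=
  [set V | V^T *m V = 1%:M /\ (nnz_rows V <= k)%N].

(* h is a row vector because diag_mx takes one. *)
Definition CR1' (R : realType) (d r k : nat) : set 'M[R]_(d, r) :=
  [set V | exists h : 'rV[R]_d,
    [/\ forall i, 0 <= h 0 i,
        \sum_(i < d) row_norm2 V i <= Num.sqrt (r * k)%:R,
        \sum_(i < d) h 0 i <= pi / 2 * k%:R,
        psdmx (block_mx 1%:M V V^T 1%:M) &
        psdmx (block_mx (diag_mx h) V V^T 1%:M)]].

Definition log2 (R : realType) (x : R) : R := ln x / ln 2.

Definition rho_CR1' (R : realType) (r : nat) : R :=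
  Num.sqrt (pi / 2) *
    (2 + Num.max (6 * Num.sqrt (2 * pi)) (12 * Num.sqrt (log2 (50 * r%:R)))).

(* Main.v *)
(* The hull of the k-row-sparse orthonormal matrices contains every k-row-sparse
   contraction W: if D = 1 - W^T W is not 0, a rank-one line through W meets,
   on both sides of W, matrices whose defect 1 - W'^T W' is D deflated to a
   smaller rank.  So if a random k-row-sparse matrix has mean V, then V lies in
   the hull scaled by the expected operator norm.

   Given V in CR1' with witness h, weigh row i by q_i = h_i / 8 + |V_i| / 4;
   these sum to at most k / 2.  Fewer than k rows have q_i > 1/2 and together
   form a contraction.  The other rows are packed into k bins of weight at most
   1, and one row is drawn from each bin, row i with probability q_i, rescaled
   to x_i = V_i / q_i.  The sampled rows satisfy |x_i|^2 <= 16 (from the row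
   norms) and sum_i q_i x_i x_i^T <= 8 (from h).

   The norm is controlled by an elementary matrix Chernoff bound for rank-one
   summands: for B >= c and |x|^2 <= L,
     tr (B + x x^T)^(p+1) <= tr B^(p+1) + (p+1) (1 + L/c)^p x^T B^p x,
   and convexity of tr (.)^(p+1) turns the average of the right-hand side into
   a bound by tr (B + (1 + L/c)^p sum_i q_i x_i x_i^T)^(p+1).  Replacing the
   random bins by their scaled means one at a time bounds the mean of
   tr (c + W^T W)^(p+1), and taking p of order log r loses only a constant. *)

Require Import Defs.
From HB Require Import structures.
From mathcomp Require Import all_boot all_order all_algebra.
From mathcomp Require Import all_classical all_reals all_analysis.
From mathcomp Require Import zify ring lra.

Set Implicit Arguments.
Unset Strict Implicit.
Unset Printing Implicit Defensive.

Import Order.TTheory GRing.Theory Num.Theory.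
Import numFieldNormedType.Exports.

Local Open Scope classical_set_scope.
Local Open Scope ring_scope.

(** * Positive semidefinite forms *)

Definition mxform (R : realType) (m n : nat) (A : 'M[R]_(m, n))
  (x : 'cV[R]_m) (y : 'cV[R]_n) : R := (x^T *m A *m y) 0 0.

Section Forms.
Context (R : realType).
Implicit Types m n : nat.

Lemma mxformT m n (A : 'M[R]_(m, n)) x y : mxform A^T y x = mxform A x y.
Proof.
rewrite /mxform; have -> : y^T *m A^T *m x = (x^T *m A *m y)^T.
  by rewrite !trmx_mul trmxK mulmxA.
by rewrite mxE.
Qed.

Lemma mxformE m n (A : 'M[R]_(m, n)) x y :
  mxform A x y = \sum_i x i 0 * (A *m y) i 0.
Proof. by rewrite /mxform -mulmxA mxE; apply: eq_bigr => i _; rewrite mxE. Qed.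

Lemma mxformDl m n (A B : 'M[R]_(m, n)) x y :
  mxform (A + B) x y = mxform A x y + mxform B x y.
Proof. by rewrite /mxform mulmxDr mulmxDl mxE. Qed.

Lemma mxformNl m n (A : 'M[R]_(m, n)) x y : mxform (- A) x y = - mxform A x y.
Proof. by rewrite /mxform mulmxN mulNmx mxE. Qed.

Lemma mxformBl m n (A B : 'M[R]_(m, n)) x y :
  mxform (A - B) x y = mxform A x y - mxform B x y.
Proof. by rewrite mxformDl mxformNl. Qed.

Lemma mxformZl m n a (A : 'M[R]_(m, n)) x y :
  mxform (a *: A) x y = a * mxform A x y.
Proof. by rewrite /mxform -scalemxAr -scalemxAl mxE. Qed.

Lemma mxform0l m n x y : mxform (0 : 'M[R]_(m, n)) x y = 0.
Proof. by rewrite /mxform mulmx0 mul0mx mxE. Qed.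

Lemma mxform_suml m n (I : Type) (s : seq I) (P : pred I)
    (F : I -> 'M[R]_(m, n)) x y :
  mxform (\sum_(i <- s | P i) F i) x y = \sum_(i <- s | P i) mxform (F i) x y.
Proof.
by apply: (big_morph (fun A => mxform A x y)) => [A B|]; rewrite ?mxformDl ?mxform0l.
Qed.

Lemma mxformDr m n (A : 'M[R]_(m, n)) x y z :
  mxform A x (y + z) = mxform A x y + mxform A x z.
Proof. by rewrite /mxform mulmxDr mxE. Qed.

Lemma mxformZr m n (A : 'M[R]_(m, n)) x y a :
  mxform A x (a *: y) = a * mxform A x y.
Proof. by rewrite /mxform -scalemxAr mxE. Qed.

Lemma mxformM m n p (A : 'M[R]_(m, n)) (B : 'M[R]_(n, p)) x y :
  mxform (A *m B) x y = mxform A x (B *m y).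
Proof. by rewrite /mxform !mulmxA. Qed.

Lemma mxformMl m n p (A : 'M[R]_(m, n)) (B : 'M[R]_(m, p)) x y :
  mxform (B^T *m A) x y = mxform A (B *m x) y.
Proof. by rewrite /mxform trmx_mul !mulmxA. Qed.

Definition sqnorm n (x : 'cV[R]_n) : R := mxform 1%:M x x.

Lemma sqnormE n (x : 'cV[R]_n) : sqnorm x = \sum_i x i 0 ^+ 2.
Proof. by rewrite /sqnorm mxformE mul1mx. Qed.

Lemma sqnorm_ge0 n (x : 'cV[R]_n) : 0 <= sqnorm x.
Proof. by rewrite sqnormE sumr_ge0 // => i _; rewrite sqr_ge0. Qed.

Lemma sqnorm_eq0 n (x : 'cV[R]_n) : (sqnorm x == 0) = (x == 0).
Proof.
apply/eqP/eqP => [|->]; last by rewrite /sqnorm /mxform mulmx0 mxE.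
rewrite sqnormE => /eqP; rewrite psumr_eq0 => [|i _]; last exact: sqr_ge0.
move=> /allP x0; apply/colP => i; have := x0 i (mem_index_enum _).
by rewrite sqrf_eq0 mxE => /eqP.
Qed.

Lemma mxform_rank1 m n (u : 'cV[R]_m) (v : 'cV[R]_n) x y :
  mxform (u *m v^T) x y = mxform 1%:M u x * mxform 1%:M v y.
Proof.
rewrite -[mxform _ u x]mxformT trmx1 /mxform !mulmx1 !mulmxA -mulmxA.
by rewrite mxE big_ord1.
Qed.

Lemma psdP n (A : 'M[R]_n) :
  psdmx A <-> A^T = A /\ forall x, 0 <= mxform A x x.
Proof.
split=> [[/is_hermitianmxP sA A0]|[sA A0]]; split => //.
  by rewrite [RHS]sA expr0 scale1r map_mx_id.
by apply/is_hermitianmxP; rewrite expr0 scale1r map_mx_id // sA.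
Qed.

Lemma psd_ge0 n (A : 'M[R]_n) x : psdmx A -> 0 <= mxform A x x.
Proof. by move=> /psdP[]. Qed.

Lemma psd_sym n (A : 'M[R]_n) : psdmx A -> A^T = A.
Proof. by move=> /psdP[]. Qed.

Lemma psd_formC n (A : 'M[R]_n) x y : psdmx A -> mxform A x y = mxform A y x.
Proof. by move=> /psd_sym sA; rewrite -mxformT sA. Qed.

Lemma psd0 n : psdmx (0 : 'M[R]_n).
Proof. by apply/psdP; split=> [|x]; rewrite ?trmx0 ?mxform0l. Qed.

Lemma psdD n (A B : 'M[R]_n) : psdmx A -> psdmx B -> psdmx (A + B).
Proof.
move=> /psdP[sA A0] /psdP[sB B0]; apply/psdP; split=> [|x].
  by rewrite linearD /= sA sB.
by rewrite mxformDl addr_ge0.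
Qed.

Lemma psdZ n a (A : 'M[R]_n) : 0 <= a -> psdmx A -> psdmx (a *: A).
Proof.
move=> a0 /psdP[sA A0]; apply/psdP; split=> [|x]; first by rewrite linearZ /= sA.
by rewrite mxformZl mulr_ge0.
Qed.

Lemma psd_sum n (I : Type) (s : seq I) (P : pred I) (F : I -> 'M[R]_n) :
  (forall i, P i -> psdmx (F i)) -> psdmx (\sum_(i <- s | P i) F i).
Proof. by move=> F0; apply: big_ind => //; [exact: psd0|exact: psdD]. Qed.

Lemma psd1 n : psdmx (1%:M : 'M[R]_n).
Proof. by apply/psdP; split=> [|x]; rewrite ?trmx1 //; exact: sqnorm_ge0. Qed.

Lemma psd_scalar n a : 0 <= a -> psdmx (a%:M : 'M[R]_n).
Proof. by move=> a0; rewrite -scalemx1; apply: psdZ => //; exact: psd1. Qed.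

Lemma psd_congr m n (A : 'M[R]_m) (B : 'M[R]_(m, n)) :
  psdmx A -> psdmx (B^T *m A *m B).
Proof.
move=> /psdP[sA A0]; apply/psdP; split=> [|x].
  by rewrite !trmx_mul sA trmxK mulmxA.
by rewrite mxformM mxformMl.
Qed.

Lemma psd_gram m n (B : 'M[R]_(m, n)) : psdmx (B^T *m B).
Proof. by rewrite -[B^T]mulmx1; apply: psd_congr; exact: psd1. Qed.

Lemma psd_rank1 n (u : 'cV[R]_n) : psdmx (u *m u^T).
Proof. by have := psd_gram u^T; rewrite trmxK. Qed.

(** The form is nonnegative on the span of [x] and [y], so its discriminant there is not
    positive. *)
Lemma psd_CS n (A : 'M[R]_n) x y : psdmx A ->
  mxform A x y ^+ 2 <= mxform A x x * mxform A y y.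
Proof.
move=> pA; set a := mxform A x x; set b := mxform A x y; set c := mxform A y y.
have quad s t : 0 <= s ^+ 2 * a + 2 * s * t * b + t ^+ 2 * c.
  have := psd_ge0 (s *: x + t *: y) pA.
  rewrite mxformDr !mxformZr ![mxform A (_ + _) _]psd_formC // !mxformDr !mxformZr.
  by rewrite [mxform A y x]psd_formC // -/a -/b -/c; nra.
have a0 : 0 <= a by exact: psd_ge0.
have c0 : 0 <= c by exact: psd_ge0.
have [c_gt0|] := ltrP 0 c; first by have := quad c (- b); nra.
move=> c_le0; have {c_le0}c0 : c = 0 by lra.
rewrite c0 mulr0.
have [->|b0] := eqVneq b 0; first by rewrite expr0n.
(* With [c = 0] the form is affine in [t], and this [t] gives it the negative value [- a - 2]. *)
have := quad 1 (- (a + 1) / b); rewrite c0 -mulrA divfK //; lra.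
Qed.

Lemma psd_form_eq0 n (A : 'M[R]_n) x : psdmx A -> mxform A x x = 0 -> A *m x = 0.
Proof.
move=> pA Ax0; apply/eqP; rewrite -sqnorm_eq0 /sqnorm.
have := psd_CS (A *m x) x pA; rewrite Ax0 mulr0 => h.
have : mxform A (A *m x) x ^+ 2 == 0 by rewrite eq_le sqr_ge0 h.
by rewrite sqrf_eq0 -{1}[A]mul1mx mxformM.
Qed.

(** Stands in for the spectral theorem: rank-one terms are peeled off by induction on the rank.
    Cauchy-Schwarz keeps the remainder semidefinite, and its kernel is that of [A] enlarged at least
    by [z]. *)
Lemma psd_deflate n (A : 'M[R]_n) z : psdmx A -> A *m z != 0 ->
  [/\ 0 < mxform A z z,
      psdmx (A - (mxform A z z)^-1 *: ((A *m z) *m (A *m z)^T)) &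
      (\rank (A - (mxform A z z)^-1 *: ((A *m z) *m (A *m z)^T))%R < \rank A)%N].
Proof.
move=> pA Az0; set d := mxform A z z; set A' := _ - _.
have d0 : 0 < d.
  rewrite lt_neqAle psd_ge0 // andbT eq_sym; apply: contra Az0 => /eqP h.
  by rewrite psd_form_eq0.
split=> //.
  apply/psdP; split=> [|x].
    by rewrite linearB linearZ /= trmx_mul trmxK psd_sym.
  rewrite mxformBl mxformZl mxform_rank1 -mxformMl mulmx1 psd_sym //.
  rewrite -expr2 subr_ge0 ler_pdivrMl //; exact: psd_CS.
have kz : (z^T <= kermx A')%MS.
  apply/sub_kermxP; rewrite mulmxBr -scalemxAr mulmxA.
  have -> : z^T *m (A *m z) = d%:M by rewrite mulmxA [LHS]mx11_scalar.
  rewrite mul_scalar_mx scalerA mulVf ?gt_eqF // scale1r trmx_mul psd_sym //.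
  by rewrite subrr.
have kA : (kermx A < kermx A')%MS.
  rewrite ltmxE; apply/andP; split.
    apply/sub_kermxP; rewrite mulmxBr -scalemxAr !mulmxA mulmx_ker !mul0mx.
    by rewrite scaler0 subrr.
  apply: contra Az0 => le; have /sub_kermxP := submx_trans kz le.
  by move=> /(congr1 trmx); rewrite trmx_mul trmxK psd_sym // trmx0 => ->.
have := rank_ltmx kA; rewrite !mxrank_ker.
by have := rank_leq_row A; have := rank_leq_row A'; lia.
Qed.

Lemma mx_neq0_ex m n (A : 'M[R]_(m, n)) : A != 0 -> exists z : 'cV_n, A *m z != 0.
Proof.
move=> A0; apply/not_existsP => h; case/eqP: A0; apply/matrixP => i j.
have /negP := h (delta_mx j 0); rewrite negbK -colE => /eqP /colP /(_ i).
by rewrite !mxE.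
Qed.

(** Each rank-one term peeled off [A] contributes a nonnegative multiple of a value of the form of
    [B]. *)
Lemma psd_trM_ge0 n (A B : 'M[R]_n) : psdmx A -> psdmx B -> 0 <= \tr (A *m B).
Proof.
move=> + pB; have [k] := ubnP (\rank A); elim: k A => // k IH A rA pA.
have [->|A0] := eqVneq A 0; first by rewrite mul0mx linear0.
have [z Az] := mx_neq0_ex A0.
have [d0 pA' rA'] := psd_deflate pA Az.
set A' := A - _ in pA' rA'.
have -> : A = A' + (mxform A z z)^-1 *: ((A *m z) *m (A *m z)^T) by rewrite subrK.
rewrite mulmxDl mxtraceD addr_ge0 //; first by apply: IH => //; lia.
rewrite -scalemxAl mxtraceZ mulr_ge0 ?invr_ge0 ?(ltW d0) // -mulmxA mxtrace_mulC.
by rewrite trace_mx11; exact: psd_ge0.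
Qed.

(** By Cauchy-Schwarz [|x|^2 - x x^T] is semidefinite, so its product with [A] has nonnegative
    trace. *)
Lemma psd_form_le_tr n (A : 'M[R]_n) x : psdmx A -> mxform A x x <= sqnorm x * \tr A.
Proof.
move=> pA; have : 0 <= \tr (((sqnorm x)%:M - x *m x^T) *m A).
  apply: psd_trM_ge0 => //; apply/psdP; split=> [|y].
    by rewrite linearB /= tr_scalar_mx trmx_mul trmxK.
  rewrite mxformBl -scalemx1 mxformZl mxform_rank1 subr_ge0 -expr2.
  exact/psd_CS/psd1.
rewrite mulmxBl linearB /= mul_scalar_mx mxtraceZ subr_ge0; apply: le_trans.
by rewrite -mulmxA mxtrace_mulC trace_mx11.
Qed.

End Forms.

(** * Traces and moments of matrix powers *)

Section ConvexSequences.
Context (R : realType).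

(** The increments grow, so their mean lies between the first and the last. *)
Lemma convex_seq_chord (f : nat -> R) p :
  (forall j, (j < p)%N -> 2 * f j.+1 <= f j + f j.+2) ->
  f 0%N + p.+1%:R * (f 1%N - f 0%N) <= f p.+1 /\
  f p.+1 <= f 0%N + p.+1%:R * (f p.+1 - f p).
Proof.
elim: p => [|p IH] fcvx; first by rewrite mul1r; split; lra.
have [|lo hi] := IH; first by move=> j jp; apply: fcvx; lia.
have h := fcvx p (leqnn _).
have slope : f 1%N - f 0%N <= f p.+2 - f p.+1.
  suff : f 1%N - f 0%N <= f p.+1 - f p by lra.
  rewrite -(ler_pM2l (ltr0Sn R p)); lra.
have step : p.+1%:R * (f p.+1 - f p) <= p.+1%:R * (f p.+2 - f p.+1).
  by rewrite ler_pM2l ?ltr0Sn //; lra.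
by rewrite -natr1 !mulrDl !mul1r; split; lra.
Qed.

(** The ratios of consecutive terms are nondecreasing; [ratio] says so without division, because
    terms may vanish. *)
Lemma log_convex_seq (a : nat -> R) i j :
  (forall n, 0 <= a n) -> (forall n, a n.+1 ^+ 2 <= a n * a n.+2) ->
  a i * a j <= a 0%N * a (i + j)%N.
Proof.
move=> a0 alc.
have ratio m n : a m.+1 * a (m + n)%N <= a m * a (m + n).+1.
  elim: n => [|n IH]; first by rewrite addn0 mulrC.
  rewrite addnS; have h := alc (m + n)%N.
  have [z|] := ltrP 0 (a (m + n).+1); last first.
    move=> /(conj (a0 (m + n).+1)) /andP; rewrite -eq_le => /eqP <-.
    by rewrite mulr0 mulr_ge0.
  have [am0|] := ltrP 0 (a (m + n)%N); last first.
    by move=> am0; have := a0 (m+n).+2; nra.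
  rewrite -(ler_pM2r z) -mulrA -expr2.
  apply: le_trans (_ : a m.+1 * (a (m + n)%N * a (m + n).+2) <= _).
    by rewrite ler_wpM2l.
  by rewrite mulrA [leRHS]mulrAC ler_wpM2r.
have diag n k : a n * a (n + k)%N <= a 0%N * a (n + (n + k))%N.
  elim: n k => [//|n IH] k.
  have -> : (n.+1 + k = n + k.+1)%N by lia.
  have -> : (n.+1 + (n + k.+1) = n + (n + k.+2))%N by lia.
  by apply: le_trans (ratio n k.+1) _; rewrite -addnS.
wlog le_ij : i j / (i <= j)%N; last by rewrite -(subnKC le_ij).
by move=> H; case/orP: (leq_total i j) => /H //; rewrite mulrC addnC.
Qed.

End ConvexSequences.

Section Powers.
Context (R : realType) (n : nat).
Implicit Types (A B C : 'M[R]_n.+1) (x : 'cV[R]_n.+1).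

(** Even powers are Gram matrices, odd powers are congruences of [A] by one of its powers. *)
Lemma psdX A m : psdmx A -> psdmx (A ^+ m).
Proof.
move=> pA; have symX k : (A ^+ k)^T = A ^+ k.
  elim: k => [|k IH]; first by rewrite expr0 trmx1.
  by rewrite exprS trmx_mul IH psd_sym // -[RHS]exprS exprSr.
have pX k : psdmx (A ^+ k.*2).
  by rewrite -addnn exprD -{1}symX; exact: psd_gram.
rewrite -(odd_double_half m); case: (odd m); last exact: pX.
rewrite add1n -addnn -addnS exprD exprS mulrA -{1}symX; exact: psd_congr.
Qed.

(* Convexity in [j] gives both Klein inequalities below by comparing the mean
   slope with the slopes at the two ends; no diagonalisation is needed. *)
Lemma trX_mixed_convex A C p j : psdmx A -> psdmx C -> (j < p)%N ->
  2 * \tr (C ^+ j.+1 * A ^+ (p.+1 - j.+1)) <=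
  \tr (C ^+ j * A ^+ (p.+1 - j)) + \tr (C ^+ j.+2 * A ^+ (p.+1 - j.+2)).
Proof.
move=> pA pC jp; set q := (p - j.+1)%N.
have -> : (p.+1 - j.+1 = q.+1)%N by rewrite /q; lia.
have -> : (p.+1 - j = q.+2)%N by rewrite /q; lia.
have -> : (p.+1 - j.+2 = q)%N by rewrite /q; lia.
have trC (X Y : 'M[R]_n.+1) : \tr (X * Y) = \tr (Y * X) := mxtrace_mulC X Y.
(* This trace is the second difference of the sequence. *)
have : 0 <= \tr (C ^+ j * ((C - A) * A ^+ q * (C - A))).
  apply: psd_trM_ge0; first exact: psdX.
  have symCA : (C - A)^T = C - A by rewrite linearB /= (psd_sym pC) (psd_sym pA).
  by rewrite -{1}symCA; apply: psd_congr; exact: psdX.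
rewrite !(mulrBl, mulrBr) !linearB /=.
have -> : \tr (C ^+ j * (C * A ^+ q * C)) = \tr (C ^+ j.+2 * A ^+ q).
  by rewrite !mulrA trC !mulrA -exprS -exprSr.
have -> : \tr (C ^+ j * (A * A ^+ q * C)) = \tr (C ^+ j.+1 * A ^+ q.+1).
  by rewrite -exprS mulrA trC mulrA -exprS.
have -> : \tr (C ^+ j * (C * A ^+ q * A)) = \tr (C ^+ j.+1 * A ^+ q.+1).
  by rewrite -mulrA -exprSr mulrA -exprSr.
have -> : \tr (C ^+ j * (A * A ^+ q * A)) = \tr (C ^+ j * A ^+ q.+2).
  by rewrite -exprS -exprSr.
by lra.
Qed.

Lemma klein_ge A C p : psdmx A -> psdmx C ->
  \tr (A ^+ p.+1) + p.+1%:R * \tr ((C - A) * A ^+ p) <= \tr (C ^+ p.+1).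
Proof.
move=> pA pC.
have [h _] := convex_seq_chord
  (f := fun j => \tr (C ^+ j * A ^+ (p.+1 - j))) (fun j jp => trX_mixed_convex pA pC jp).
move: h; rewrite /= subnn subn0 subn1 /= !expr0 expr1 mul1r mulr1.
by rewrite mulrBl -exprS linearB.
Qed.

Lemma klein_le A C p : psdmx A -> psdmx C ->
  \tr (C ^+ p.+1) <= \tr (A ^+ p.+1) + p.+1%:R * \tr ((C - A) * C ^+ p).
Proof.
move=> pA pC.
have [_ h] := convex_seq_chord
  (f := fun j => \tr (C ^+ j * A ^+ (p.+1 - j))) (fun j jp => trX_mixed_convex pA pC jp).
move: h; rewrite /= subnn subn0 subSnn /= !expr0 expr1 mul1r mulr1.
by rewrite mulrBl -exprS linearB /= [X in _ - X]mxtrace_mulC.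
Qed.

Lemma trX_monotone A C p : psdmx A -> psdmx (C - A) ->
  \tr (A ^+ p.+1) <= \tr (C ^+ p.+1).
Proof.
move=> pA pCA; have pC : psdmx C by rewrite -(subrK A C); exact: psdD.
apply: le_trans (klein_ge p pA pC); rewrite lerDl mulr_ge0 //.
exact/psd_trM_ge0/psdX.
Qed.

(** Cauchy-Schwarz for the form of [B ^+ k], at [x] and [B *m x], makes the moments log-convex. *)
Lemma moment_log_convex B x i j : psdmx B ->
  mxform (B ^+ i) x x * mxform (B ^+ j) x x <= sqnorm x * mxform (B ^+ (i + j)) x x.
Proof.
move=> pB; apply: (log_convex_seq (a := fun i => mxform (B ^+ i) x x)) => [k|k].
  exact/psd_ge0/psdX.
have := psd_CS x (B *m x) (psdX k pB); rewrite -!mxformM !mulmxE -!exprSr.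
suff -> : mxform (B ^+ k.+1) (B *m x) x = mxform (B ^+ k.+2) x x by [].
by rewrite -mxformMl psd_sym // mulmxE -exprS.
Qed.

(** Jensen's inequality for the spectral measure of [B] at [x], obtained from log-convexity of the
    moments alone. *)
Lemma moment_power B x p : psdmx B ->
  mxform B x x ^+ p.+1 <= sqnorm x ^+ p * mxform (B ^+ p.+1) x x.
Proof.
move=> pB; elim: p => [|p IH]; first by rewrite !expr1 expr0 mul1r.
rewrite exprS; apply: le_trans (ler_wpM2l (psd_ge0 x pB) IH) _.
rewrite mulrCA [sqnorm x ^+ p.+1]exprSr -mulrA ler_wpM2l ?exprn_ge0 ?sqnorm_ge0 //.
by have := moment_log_convex x 1 p.+1 pB; rewrite expr1.
Qed.

(** Expanding one factor at a time, each [x x^T] cuts a moment into a product of two. Log-convexity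
    merges the product at the price of [|x|^2 <= L], and raising the order of the moment by one pays
    back [c]. *)
Lemma rank1_update_moment B x c L m : psdmx (B - c%:M) -> 0 < c ->
  sqnorm x <= L ->
  mxform ((B + x *m x^T) ^+ m) x x <= (1 + L / c) ^+ m * mxform (B ^+ m) x x.
Proof.
move=> pBc c0 xL; have L0 : 0 <= L by apply: le_trans xL; exact: sqnorm_ge0.
have pB : psdmx B by rewrite -(subrK c%:M B); exact/psdD/psd_scalar/ltW.
have pX i : 0 <= mxform (B ^+ i) x x by exact/psd_ge0/psdX.
have incr i : c * mxform (B ^+ i) x x <= mxform (B ^+ i.+1) x x.
  have [->|x0] := eqVneq x 0; first by rewrite /mxform !mulmx0 !mxE mulr0.
  have nx : 0 < sqnorm x by rewrite lt_neqAle eq_sym sqnorm_eq0 x0 sqnorm_ge0.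
  rewrite -(ler_pM2l nx); apply: le_trans (moment_log_convex x 1 i pB).
  rewrite mulrA ler_wpM2r // expr1 mulrC -mxformZl scalemx1 -subr_ge0 -mxformBl.
  exact: psd_ge0.
(* Expanding the first factor leads to exponent [i.+1] and to a product of the moment [i] with the
   case [0], so the induction on [m] needs every [i]. *)
suff gen i : mxform (B ^+ i * (B + x *m x^T) ^+ m) x x <=
    (1 + L / c) ^+ m * mxform (B ^+ (i + m)) x x.
  by have := gen 0%N; rewrite expr0 mul1r.
elim: m i => [|m IH] i; first by rewrite addn0 !expr0 mulr1 mul1r.
rewrite exprS mulrA mulrDr -exprSr mulrDl mxformDl.
have -> : mxform (B ^+ i * (x *m x^T) * (B + x *m x^T) ^+ m) x x =
    mxform (B ^+ i) x x * mxform (B ^+ 0 * (B + x *m x^T) ^+ m) x x.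
  rewrite mul1r mxformM mxformM.
  have -> : x *m x^T *m ((B + x *m x^T) ^+ m *m x) = mxform ((B + x *m x^T) ^+ m) x x *: x.
    by rewrite -mulmxA [X in x *m X]mx11_scalar mul_mx_scalar mulmxA.
  by rewrite mxformZr mulrC.
have hm := IH 0%N; have hi := IH i.+1.
have K0 : 0 <= (1 + L / c) ^+ m by rewrite exprn_ge0 // addr_ge0 // divr_ge0 // ltW.
apply: le_trans (lerD hi (ler_wpM2l (pX i) hm)) _.
rewrite mulrCA -mulrDr exprSr -mulrA ler_wpM2l //.
rewrite mulrDl mul1r addnS addSn lerD // add0n.
apply: le_trans (moment_log_convex x i m pB) _.
apply: le_trans (ler_wpM2r (pX _) xL) _.
by rewrite -mulrA ler_wpM2l // ler_pdivlMl.
Qed.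

End Powers.

(** * Sparse contractions *)

Section ConvexSets.
Context (R : realType) (M : lmodType R).
Implicit Types (K S : set M) (Z W : M).

Lemma convex_setP K : @convex_set R M K <->
  forall t x y, 0 <= t -> t <= 1 -> K x -> K y -> K (t *: x + (1 - t) *: y).
Proof.
split=> [cK t x y t0 t1 Kx Ky|cK x y t].
  have t01 : t \in `[0, 1]%R by rewrite in_itv /= t0 t1.
  have /set_mem := cK x y (Itv01 t0 t1) (mem_set Kx) (mem_set Ky).
  by [].
by move=> /set_mem Kx /set_mem Ky; apply/mem_set/cK.
Qed.

Lemma convex_hull_convex S : @convex_set R M (convex_hull S).
Proof.
apply/convex_setP => t x y t0 t1 Sx Sy K [cK SK].
by move/convex_setP: (cK); apply=> //; [exact: Sx|exact: Sy].
Qed.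

(** Membership of [Z] in [a K] says that the gauge of [K] at [Z] is at most [a]; this is
    subadditivity of the gauge. *)
Lemma scaled_convexD K a b Z W : @convex_set R M K -> 0 <= a -> 0 <= b ->
  [set a *: V | V in K] Z -> [set b *: V | V in K] W ->
  [set (a + b) *: V | V in K] (Z + W).
Proof.
move=> /convex_setP cK a0 b0 [V KV <-] [V' KV' <-].
have [ab|ab] := eqVneq (a + b) 0.
  have [-> ->] : a = 0 /\ b = 0 by split; lra.
  by exists V; rewrite // addr0 !scale0r addr0.
have ab0 : 0 < a + b by rewrite lt_neqAle eq_sym ab addr_ge0.
exists (a / (a + b) *: V + (1 - a / (a + b)) *: V').
  apply: cK => //; first by rewrite divr_ge0 // ltW.
  by rewrite ler_pdivrMr //; lra.
rewrite scalerDr !scalerA mulrC divfK //; congr (_ + _ *: _).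
by rewrite mulrBr mulr1 mulrC divfK //; lra.
Qed.

Lemma scaled_convexZ K a b Z : [set b *: V | V in K] Z ->
  [set (a * b) *: V | V in K] (a *: Z).
Proof. by case=> V KV <-; exists V; rewrite ?scalerA. Qed.

Lemma scaled_convex_le K a b Z : @convex_set R M K -> K 0 -> 0 <= a -> a <= b ->
  [set a *: V | V in K] Z -> [set b *: V | V in K] Z.
Proof.
move=> cK K0 a0 ab aZ; have := @scaled_convexD K a (b - a) Z 0 cK a0.
rewrite addr0 addrCA subrr addr0; apply=> //; first by rewrite subr_ge0.
by exists 0; rewrite ?scaler0.
Qed.

Lemma scaled_convex_sum K (I : Type) (s : seq I) (P : pred I) (b : I -> R)
    (F : I -> M) :
  @convex_set R M K -> K 0 -> (forall i, P i -> 0 <= b i) ->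
  (forall i, P i -> [set b i *: V | V in K] (F i)) ->
  [set (\sum_(i <- s | P i) b i) *: V | V in K] (\sum_(i <- s | P i) F i).
Proof.
move=> cK K0 b0 bF; have [] // : 0 <= \sum_(i <- s | P i) b i /\
    [set (\sum_(i <- s | P i) b i) *: V | V in K] (\sum_(i <- s | P i) F i).
apply: (big_ind2 (fun a Z => 0 <= a /\ [set a *: V | V in K] Z)).
- by split=> //; exists 0; rewrite ?scaler0.
- move=> a Z a' Z' [a0 Za] [a'0 Za']; split; first exact: addr_ge0.
  exact: scaled_convexD.
- by move=> i Pi; split; [exact: b0|exact: bF].
Qed.

End ConvexSets.

Section Contractions.
Context (R : realType).

(** The product of the roots is [- s / a]. They are the two points, one on each side of [W], at
    which the defect drops in rank. *)
Lemma quadratic_roots_opposite_sign (a c s : R) : 0 < a -> 0 < s ->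
  exists t1 t2, [/\ t1 < 0, 0 < t2,
    2 * t1 * c + t1 ^+ 2 * a = s & 2 * t2 * c + t2 ^+ 2 * a = s].
Proof.
move=> a0 s0; set e := Num.sqrt (c ^+ 2 + a * s).
have e2 : e ^+ 2 = c ^+ 2 + a * s.
  by rewrite sqr_sqrtr // addr_ge0 ?sqr_ge0 // mulr_ge0 // ltW.
have e0 : 0 <= e by exact: sqrtr_ge0.
have as0 : 0 < a * s by exact: mulr_gt0.
have [ce1 ce2] : - e < c /\ c < e by split; nra.
exists ((- c - e) / a), ((- c + e) / a); split.
- by rewrite pmulr_llt0 ?invr_gt0 //; lra.
- by rewrite divr_gt0 //; lra.
- have -> : 2 * ((- c - e) / a) * c + ((- c - e) / a) ^+ 2 * a =
    (e ^+ 2 - c ^+ 2) / a by field; rewrite gt_eqF.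
  by rewrite e2 addrC addKr mulrC mulKf // gt_eqF.
- have -> : 2 * ((- c + e) / a) * c + ((- c + e) / a) ^+ 2 * a =
    (e ^+ 2 - c ^+ 2) / a by field; rewrite gt_eqF.
  by rewrite e2 addrC addKr mulrC mulKf // gt_eqF.
Qed.

Definition contraction_mx d r (W : 'M[R]_(d, r)) := psdmx (1%:M - W^T *m W).

Definition supported_on d r (S : {set 'I_d}) (W : 'M[R]_(d, r)) :=
  forall i j, i \notin S -> W i j = 0.

Lemma supported_diag d r (S : {set 'I_d}) (W : 'M[R]_(d, r)) :
  supported_on S W <-> diag_mx (\row_i (i \in S)%:R) *m W = W.
Proof.
rewrite mul_diag_mx; split=> [SW|WE].
  apply/matrixP => i j; rewrite !mxE; have [|/SW ->] := boolP (i \in S).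
    by rewrite mul1r.
  by rewrite mulr0.
by move=> i j iS; rewrite -WE !mxE (negbTE iS) mul0r.
Qed.

(** The direction sought is [a u^T] with [u = D z] and [W^T a] parallel to [u], so that moving along
    it changes [D] only by multiples of [u u^T]. With [P] the projection on the rows in [S], the
    identity [W^T (P - W W^T) = D W^T] provides it: either [D W^T b] is nonzero for some [b], or
    [W^T] kills the range of [P - W W^T]. *)
Lemma contraction_slack_direction d r (S : {set 'I_d}) (W : 'M[R]_(d, r)) :
  contraction_mx W -> supported_on S W -> (r <= #|S|)%N ->
  1%:M - W^T *m W != 0 ->
  exists c (a : 'cV_d) (z : 'cV_r), [/\ W^T *m a = c *: ((1%:M - W^T *m W) *m z),
    a != 0, supported_on S a & (1%:M - W^T *m W) *m z != 0].
Proof.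
move=> cW SW rS; set D := _ - _ => D0.
set P : 'M[R]_d := diag_mx (\row_i (i \in S)%:R).
have PW : P *m W = W by exact/supported_diag.
have PT : P^T = P by rewrite tr_diag_mx.
have PP : P *m P = P.
  apply/supported_diag => i j iS; rewrite !mxE (negbTE iS).
  by rewrite mul0rn.
have WM b : W^T *m ((P - W *m W^T) *m b) = D *m (W^T *m b).
  rewrite mulmxA mulmxBr mulmxA -{1}PT -trmx_mul PW [RHS]mulmxA; congr (_ *m _).
  by rewrite mulmxBl mul1mx.
have SM b : supported_on S ((P - W *m W^T) *m b).
  by apply/supported_diag; rewrite mulmxA mulmxBr PP mulmxA PW.
have [[b Db]|noDb] := pselect (exists b : 'cV_d, D *m (W^T *m b) != 0).
  exists 1, ((P - W *m W^T) *m b), (W^T *m b); split=> //.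
    by rewrite WM scale1r.
  by apply: contra Db => /eqP h; rewrite -WM h mulmx0.
have Db (b : 'cV_d) : D *m (W^T *m b) = 0.
  by apply/eqP; apply: contra_notT noDb => h; exists b.
have [z Dz] := mx_neq0_ex D0.
(* If [P = W W^T], then [D] has trace [r - |S| <= 0], which forces the semidefinite [D] to
   vanish. *)
have [b Mb] : exists b : 'cV_d, (P - W *m W^T) *m b != 0.
  apply: mx_neq0_ex; apply: contra_neq D0 => /eqP; rewrite subr_eq0 => /eqP PE.
  have trP : \tr P = #|S|%:R.
    rewrite mxtrace_diag -sumr_const [RHS]big_mkcond /=.
    by apply: eq_bigr => i _; rewrite mxE; case: (i \in S).
  have trD : \tr D <= 0.
    by rewrite linearB /= mxtrace1 mxtrace_mulC -PE trP subr_le0 ler_nat.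
  apply/eqP; apply: contraT => /mx_neq0_ex [y] /eqP[].
  apply: psd_form_eq0 => //; apply/eqP; rewrite eq_le psd_ge0 // andbT.
  apply: le_trans (psd_form_le_tr y cW) _; rewrite mulr_ge0_le0 // sqnorm_ge0 //.
exists 0, ((P - W *m W^T) *m b), z; split=> //.
by rewrite WM Db scale0r.
Qed.

Lemma contraction_in_hull d r k (S : {set 'I_d}) (W : 'M[R]_(d, r)) :
  contraction_mx W -> supported_on S W -> (r <= #|S|)%N -> (#|S| <= k)%N ->
  convex_hull (@sparse_orthonormal R d r k) W.
Proof.
move=> + + rS Sk; have [m] := ubnP (\rank (1%:M - W^T *m W)).
elim: m W => // m IH W rk cW SW.
have [/eqP|D0] := eqVneq (1%:M - W^T *m W) 0.
  rewrite subr_eq0 => /eqP WW; apply: sub_gen_smallest; split=> //.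
  apply: leq_trans Sk; apply: subset_leq_card; apply/fintype.subsetP => i.
  rewrite inE; apply: contraR => iS; apply/eqP/rowP => j.
  by rewrite !mxE SW.
have [c [a [z [Wa a0 Sa]]]] := contraction_slack_direction cW SW rS D0.
set u := _ *m z => u0.
have [d0 psd' rk'] := psd_deflate cW u0; rewrite -/u in psd' rk'.
set dd := mxform _ z z in d0 psd' rk'.
have na : 0 < sqnorm a by rewrite lt_neqAle eq_sym sqnorm_eq0 a0 sqnorm_ge0.
have dV : 0 < dd^-1 by rewrite invr_gt0.
have [t1 [t2 [t1n t2p e1 e2]]] := quadratic_roots_opposite_sign c na dV.
(* The left side is the coefficient of [u u^T] by which [W^T W] grows; the value [dd^-1] is the one
   that deflates [D]. *)
have perturb t : 2 * t * c + t ^+ 2 * sqnorm a = dd^-1 ->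
    convex_hull (@sparse_orthonormal R d r k) (W + t *: (a *m u^T)).
  move=> et.
  have E : 1%:M - (W + t *: (a *m u^T))^T *m (W + t *: (a *m u^T)) =
      1%:M - W^T *m W - dd^-1 *: (u *m u^T).
    rewrite -addrA -opprD; congr (_ - _).
    have aW : a^T *m W = c *: u^T by rewrite -[W]trmxK -trmx_mul Wa linearZ.
    have aa : a^T *m a = (sqnorm a)%:M.
      by rewrite [LHS]mx11_scalar /sqnorm /mxform mulmx1.
    have -> : (W + t *: (a *m u^T))^T = W^T + t *: (u *m a^T).
      by rewrite linearD /= linearZ /= trmx_mul trmxK.
    rewrite mulmxDl !mulmxDr -addrA; congr (_ + _).
    rewrite -!scalemxAl -!scalemxAr !mulmxA Wa -[u *m a^T *m W]mulmxA aW.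
    rewrite -[u *m a^T *m a]mulmxA aa mul_mx_scalar -scalemxAl -scalemxAr -scalemxAl.
    by rewrite !scalerA -!scalerDl -et; congr (_ *: _); ring.
  apply: IH; rewrite /contraction_mx ?E //; first by apply: leq_trans rk' _.
  move=> i j iS; rewrite !mxE SW // add0r big1 ?mulr0 // => l _.
  by rewrite Sa // mul0r.
have t21 : 0 < t2 - t1 by lra.
have := @convex_hull_convex R _ (@sparse_orthonormal R d r k).
(* This weight makes the average of [t1] and [t2] zero, so the combination is [W]. *)
move=> /convex_setP /(_ (t2 / (t2 - t1)) _ _ _ _ (perturb _ e1) (perturb _ e2)).
have l0 : 0 <= t2 / (t2 - t1) by rewrite divr_ge0 // ltW.
have l1 : t2 / (t2 - t1) <= 1 by rewrite ler_pdivrMr //; lra.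
move=> /(_ l0 l1); congr convex_hull.
rewrite !scalerDr addrACA -scalerDl [_ + (1 - _)]addrC subrK scale1r !scalerA -scalerDl.
have -> : t2 / (t2 - t1) * t1 + (1 - t2 / (t2 - t1)) * t2 = 0.
  by field; rewrite gt_eqF.
by rewrite scale0r addr0.
Qed.

Lemma supset_of_card (T : finType) (S : {set T}) k : (#|S| <= k <= #|T|)%N ->
  exists2 S' : {set T}, S \subset S' & #|S'| = k.
Proof.
case/andP; elim: k => [|k IH].
  by rewrite leqn0 => /eqP S0 _; exists S.
rewrite leq_eqVlt => /orP[/eqP Sk _|]; first by exists S.
rewrite ltnS => Sk kT; have [S' SS' cS'] := IH Sk (ltnW kT).
have [x xS'] : exists x, x \notin S'.
  apply/existsP; rewrite -negb_forall; apply/negP => /forallP h.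
  suff : (#|T| <= #|S'|)%N by rewrite cS' leqNgt kT.
  by apply/subset_leq_card/fintype.subsetP.
exists (x |: S'); first by apply: fintype.subset_trans SS' _; exact: finset.subsetUr.
by rewrite cardsU1 xS' cS'.
Qed.

(** [S] may have fewer than [r] rows, so it is first enlarged to exactly [k]. *)
Lemma sparse_contraction_in_hull d r k (S : {set 'I_d}) (W : 'M[R]_(d, r)) :
  (r <= k <= d)%N -> (#|S| <= k)%N -> contraction_mx W -> supported_on S W ->
  convex_hull (@sparse_orthonormal R d r k) W.
Proof.
move=> /andP[rk kd] Sk cW SW.
have [|S' SS' S'k] := @supset_of_card _ S k; first by rewrite Sk card_ord.
apply: (contraction_in_hull (S := S')) => //; rewrite ?S'k // => i j iS'.
by apply: SW; apply: contra iS'; exact: (fintype.subsetP SS').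
Qed.

Lemma zero_in_hull d r k : (r <= k <= d)%N -> convex_hull (@sparse_orthonormal R d r k) 0.
Proof.
move=> rkd; apply: (sparse_contraction_in_hull (S := finset.set0)) => //.
- by rewrite cards0.
- by rewrite /contraction_mx trmx0 mul0mx subr0; exact: psd1.
- by move=> i j _; rewrite mxE.
Qed.

End Contractions.

(** * Stratified row sampling *)

Section Sampling.
Context (R : realType).

Lemma bernoulli_ge0 (u : R) n : 0 <= u -> 1 + n%:R * (u - 1) <= u ^+ n.
Proof.
move=> u0; elim: n => [|n IH]; first by rewrite mul0r addr0 expr0.
rewrite exprS; apply: le_trans (ler_wpM2l u0 IH).
have : 0 <= n%:R * (u - 1) ^+ 2 by rewrite mulr_ge0 ?sqr_ge0.
by rewrite -natr1; nra.
Qed.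

(** The weight left over by [q] is that of drawing nothing. Klein's upper bound for each draw leaves
    a moment of the updated matrix, which [rank1_update_moment] brings back to [B]; Klein's lower
    bound then absorbs the sum of these linear terms. *)
Lemma trX_rank1_sampling n (I : finType) (P : pred I) (q : I -> R)
    (x : I -> 'cV[R]_n.+1) (B : 'M[R]_n.+1) (c L : R) p :
  psdmx (B - c%:M) -> 0 < c -> (forall i, 0 <= q i) ->
  (forall i, sqnorm (x i) <= L) ->
  \sum_(i | P i) q i * \tr ((B + x i *m (x i)^T) ^+ p.+1) +
    (1 - \sum_(i | P i) q i) * \tr (B ^+ p.+1) <=
  \tr ((B + (1 + L / c) ^+ p *: \sum_(i | P i) q i *: (x i *m (x i)^T)) ^+ p.+1).
Proof.
move=> pBc c0 q0 xL; set K := (1 + L / c) ^+ p.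
have pB : psdmx B by rewrite -(subrK c%:M B); exact/psdD/psd_scalar/ltW.
have trF (M : 'M[R]_n.+1) y : \tr (y *m y^T *m M) = mxform M y y.
  by rewrite -mulmxA mxtrace_mulC trace_mx11.
have L0 i : 0 <= L := le_trans (sqnorm_ge0 (x i)) (xL i).
have step i : q i * \tr ((B + x i *m (x i)^T) ^+ p.+1) <=
    q i * \tr (B ^+ p.+1) + p.+1%:R * (K * (q i * mxform (B ^+ p) (x i) (x i))).
  have pC : psdmx (B + x i *m (x i)^T) by apply: psdD => //; exact: psd_rank1.
  have := klein_le p pB pC; rewrite [B + _ - B]addrAC subrr add0r -mulmxE trF => h.
  have h' := rank1_update_moment p pBc c0 (xL i).
  rewrite [K * _]mulrCA [p.+1%:R * _]mulrCA -mulrDr ler_wpM2l //.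
  by apply: le_trans h _; rewrite lerD2l ler_wpM2l.
apply: le_trans (lerD (ler_sum _ (fun i _ => step i)) (lexx _)) _.
rewrite big_split /= -mulr_suml -!mulr_sumr addrAC -mulrDl addrC.
rewrite [_ + (1 - _)]addrC subrK mul1r addrC.
have pE : psdmx (K *: \sum_(i | P i) q i *: (x i *m (x i)^T)).
  case: (pickP P) => [i Pi|P0]; last by rewrite big_pred0 // scaler0; exact: psd0.
  apply: psdZ; first by rewrite exprn_ge0 // addr_ge0 // divr_ge0 ?(L0 i) // ltW.
  by apply: psd_sum => j _; apply: psdZ => //; exact: psd_rank1.
apply: le_trans (klein_ge p pB (psdD pB pE)).
rewrite lerD2l [B + _ - B]addrAC subrr add0r -mulmxE -scalemxAl mxtraceZ.
rewrite ler_wpM2l // mulmx_suml linear_sum /=.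
rewrite le_eqVlt; apply/orP; left; apply/eqP; congr (_ * _); apply: eq_bigr => i _.
by rewrite -scalemxAl mxtraceZ trF.
Qed.

(* The tangent line of [T |-> T ^ (1 / (2 n))] at [Q ^ n]. *)
Definition root_tangent (Q : R) n (T : R) : R :=
  Num.sqrt Q * (1 + (T / Q ^+ n - 1) / n.*2%:R).

Lemma root_tangent_le (Q : R) n (T T' : R) : 0 < Q -> T <= T' ->
  root_tangent Q n T <= root_tangent Q n T'.
Proof.
move=> Q0 TT'; rewrite /root_tangent ler_wpM2l ?sqrtr_ge0 // lerD2l.
by rewrite ler_wpM2r // lerB // ler_wpM2r // invr_ge0 exprn_ge0 // ltW.
Qed.

Lemma root_tangent_gt0 (Q : R) n (T : R) : 0 < Q -> 0 <= T -> 0 < root_tangent Q n.+1 T.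
Proof.
move=> Q0 T0; apply: mulr_gt0; first by rewrite sqrtr_gt0.
have : 0 <= T / Q ^+ n.+1 by rewrite divr_ge0 // exprn_ge0 // ltW.
set t := _ / _ => t0.
have : (- 1) / n.+1.*2%:R <= (t - 1) / n.+1.*2%:R.
  by rewrite ler_wpM2r // lerBrDr addrC subrr.
rewrite -(lerD2l 1); apply: lt_le_trans.
by rewrite mulN1r subr_gt0 invf_lt1 ?ltr0n // ltr1n; lia.
Qed.

Lemma root_tangent_Qn (Q : R) n : 0 < Q -> root_tangent Q n (Q ^+ n) = Num.sqrt Q.
Proof.
by move=> Q0; rewrite /root_tangent divff ?expf_neq0 ?gt_eqF // subrr mul0r addr0 mulr1.
Qed.

(** An affine bound on the norm commutes with averaging, so controlling the mean trace is enough. *)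
Lemma root_tangent_affine Q n (I : finType) (P : pred I) (q t : I -> R) T :
  \sum_(i | P i) q i * root_tangent Q n (t i) +
    (1 - \sum_(i | P i) q i) * root_tangent Q n T =
  root_tangent Q n (\sum_(i | P i) q i * t i + (1 - \sum_(i | P i) q i) * T).
Proof.
set a := Num.sqrt Q * (1 - n.*2%:R^-1); set b := Num.sqrt Q / Q ^+ n / n.*2%:R.
have tE s : root_tangent Q n s = a + b * s by rewrite /root_tangent /a /b; ring.
under eq_bigr do rewrite tE mulrDr [q _ * (b * _)]mulrCA.
by rewrite big_split /= -mulr_suml -mulr_sumr !tE; ring.
Qed.

(** The largest eigenvalue of [W^T W], to the power [p.+1], is at most the trace, and the tangent
    lies above the root. *)
Lemma gram_le_root_tangent m n (W : 'M[R]_(m, n.+1)) (c Q : R) p : 0 <= c -> 0 < Q ->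
  let b := root_tangent Q p.+1 (\tr ((c%:M + W^T *m W) ^+ p.+1)) in
  0 < b /\ contraction_mx (b^-1 *: W).
Proof.
move=> c0 Q0 /=; set T := \tr _.
have pS : psdmx (W^T *m W) by exact: psd_gram.
have pc : psdmx (c%:M : 'M[R]_n.+1) by exact: psd_scalar.
have T0 : 0 <= T.
  have := psd_trM_ge0 (psd1 R n.+1) (psdX p.+1 (psdD pc pS)).
  by rewrite mul1mx.
have b0 := root_tangent_gt0 p Q0 T0; set b := root_tangent _ _ _ in b0 *.
split=> //; apply/psdP; split=> [|y].
  by rewrite linearB /= trmx1 trmx_mul trmxK.
have -> : (b^-1 *: W)^T = b^-1 *: W^T by rewrite linearZ.
rewrite -scalemxAl -scalemxAr scalerA mxformBl mxformZl subr_ge0.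
rewrite -[mxform 1%:M y y]/(sqnorm y) -invfM ler_pdivrMl ?(mulr_gt0 b0 b0) //.
have [->|y0] := eqVneq y 0; first by rewrite /sqnorm /mxform !mulmx0 mxE mulr0.
have N0 : 0 < sqnorm y by rewrite lt_neqAle eq_sym sqnorm_eq0 y0 sqnorm_ge0.
set s := mxform _ y y; have s0 : 0 <= s by exact: psd_ge0.
have sT : (s / sqnorm y) ^+ p.+1 <= T.
  rewrite expr_div_n ler_pdivrMr ?exprn_gt0 //.
  apply: le_trans (moment_power y p pS) _.
  rewrite [sqnorm y ^+ p.+1]exprSr [T * _]mulrCA ler_wpM2l ?exprn_ge0 ?sqnorm_ge0 //.
  rewrite [T * _]mulrC.
  apply: le_trans (psd_form_le_tr y (psdX p.+1 pS)) _.
  rewrite ler_wpM2l ?sqnorm_ge0 //; apply: trX_monotone => //.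
  by rewrite addrK.
(* Here [u] is [|W y| / |y|] in units of [sqrt Q]; Bernoulli's inequality with exponent [2 (p + 1)]
   puts it below the tangent. *)
set u := Num.sqrt (s / sqnorm y / Q).
have u2 : u ^+ 2 = s / sqnorm y / Q by rewrite sqr_sqrtr // !divr_ge0 // ltW.
have u0 : 0 <= u by exact: sqrtr_ge0.
have uT : u ^+ p.+1.*2 <= T / Q ^+ p.+1.
  by rewrite -mul2n exprM u2 expr_div_n ler_wpM2r // invr_ge0 exprn_ge0 // ltW.
have ub : u <= 1 + (T / Q ^+ p.+1 - 1) / p.+1.*2%:R.
  rewrite -lerBlDl ler_pdivlMr ?ltr0n // mulrC.
  by rewrite lerBrDl; exact: le_trans (bernoulli_ge0 _ u0) uT.
have ub2 : u * Num.sqrt Q <= b by rewrite mulrC ler_wpM2l ?sqrtr_ge0.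
have : (u * Num.sqrt Q) ^+ 2 <= b ^+ 2.
  by rewrite ler_sqr ?nnegrE ?(ltW b0) // (mulr_ge0 u0 (sqrtr_ge0 Q)).
rewrite exprMn u2 (sqr_sqrtr (ltW Q0)) divfK ?gt_eqF // ler_pdivrMr //.
Qed.

(* [W] holds the rows already drawn from the bins [n, n + 1, ...]; the bins
   below [n] still contribute their means. *)
Lemma stratified_sampling d r k p (S : {set 'I_d}) (W : 'M[R]_(d, r.+1))
    (q : 'I_d -> R) (x : 'I_d -> 'cV[R]_r.+1) (g : 'I_d -> nat) (c L Q : R) n :
  (r.+1 <= k <= d)%N -> 0 < c -> 0 < Q -> (forall i, 0 <= q i) ->
  (forall i, sqnorm (x i) <= L) ->
  (forall t, \sum_(i | g i == t) q i <= 1) ->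
  (n <= k)%N -> (#|S| <= k - n)%N -> (forall i, i \in S -> (n <= g i)%N) ->
  supported_on S W ->
  [set root_tangent Q p.+1 (\tr ((c%:M + W^T *m W + (1 + L / c) ^+ p *:
         \sum_(i | (g i < n)%N) q i *: (x i *m (x i)^T)) ^+ p.+1)) *: V |
     V in convex_hull (@sparse_orthonormal R d r.+1 k)]
  (W + \sum_(i | (g i < n)%N) q i *: (delta_mx i 0 *m (x i)^T)).
Proof.
move=> rkd c0 Q0 q0 xL gq; set K := (1 + L / c) ^+ p.
have L0 (i : 'I_d) : 0 <= L by apply: le_trans (xL i); exact: sqnorm_ge0.
set H := convex_hull _; have cH : @convex_set R _ H by exact: convex_hull_convex.
have H0 : H 0 by exact: zero_in_hull.
elim: n S W => [|n IH] S W nk Sk Sg SW.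
  (* No bin is pending: [W] has at most [k] nonzero rows, and its tangent value rescales it to a
     contraction. *)
  rewrite !big_pred0 // scaler0 !addr0.
  have [b0 cW] := gram_le_root_tangent W p (ltW c0) Q0.
  set b := root_tangent _ _ _ in b0 cW *.
  exists (b^-1 *: W); last by rewrite scalerA divff ?gt_eqF // scale1r.
  apply: sparse_contraction_in_hull cW _ => //; first by rewrite -[k]subn0; exact: Sk.
  by move=> i j iS; rewrite mxE SW // mulr0.
set E := K *: \sum_(i | (g i < n)%N) q i *: (x i *m (x i)^T).
set Z := \sum_(i | (g i < n)%N) q i *: (delta_mx i 0 *m (x i)^T).
set B := c%:M + W^T *m W + E.
have splitS (V : nmodType) (F : 'I_d -> V) : \sum_(i | (g i < n.+1)%N) F i =
    \sum_(i | g i == n) F i + \sum_(i | (g i < n)%N) F i.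
  rewrite (bigID (fun i => g i == n)) /=; congr (_ + _); apply: eq_bigl => i; lia.
have pE : psdmx E.
  rewrite /E; case: (pickP (fun i => g i < n)%N) => [i Pi|P0]; last first.
    by rewrite big_pred0 // scaler0; exact: psd0.
  apply: psdZ; first by rewrite exprn_ge0 // addr_ge0 // divr_ge0 ?(L0 i) // ltW.
  by apply: psd_sum => j _; apply: psdZ => //; exact: psd_rank1.
have pBc : psdmx (B - c%:M).
  rewrite /B -[c%:M + _ + E]addrA [c%:M + _ - _]addrAC subrr add0r.
  by apply: psdD => //; exact: psd_gram.
have pB : psdmx B by rewrite -(subrK c%:M B); exact/psdD/psd_scalar/ltW.
have trpos (C : 'M[R]_r.+1) : psdmx C -> 0 <= \tr (C ^+ p.+1).
  by move=> pC; have := psd_trM_ge0 (psd1 R r.+1) (psdX p.+1 pC); rewrite mul1mx.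
have picked i : g i == n ->
    [set root_tangent Q p.+1 (\tr ((B + x i *m (x i)^T) ^+ p.+1)) *: V | V in H]
    (W + delta_mx i 0 *m (x i)^T + Z).
  (* The rows of [S] come from bins beyond [n], so row [i] of [W] is zero and the Gram matrix grows
     by exactly [x_i x_i^T]. *)
  move=> /eqP gi; have iS : i \notin S by apply/negP => /Sg; rewrite gi ltnn.
  have -> : B + x i *m (x i)^T =
      c%:M + (W + delta_mx i 0 *m (x i)^T)^T *m (W + delta_mx i 0 *m (x i)^T) + E.
    have We : W^T *m (delta_mx i 0 : 'cV_d) = 0.
      by rewrite -colE; apply/colP => j; rewrite !mxE SW.
    have eW : (delta_mx i 0 : 'cV[R]_d)^T *m W = 0.
      by apply: trmx_inj; rewrite trmx_mul trmxK We trmx0.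
    have ee : (delta_mx i 0 : 'cV[R]_d)^T *m (delta_mx i 0 : 'cV_d) = 1%:M.
      rewrite trmx_delta mul_delta_mx; apply/matrixP => a b.
      by rewrite !ord1 !mxE.
    have -> : (W + delta_mx i 0 *m (x i)^T)^T = W^T + x i *m (delta_mx i 0)^T.
      by rewrite linearD /= trmx_mul trmxK.
    rewrite mulmxDl !mulmxDr mulmxA We mul0mx addr0.
    rewrite -[x i *m _ *m W]mulmxA eW mulmx0 add0r.
    rewrite -[x i *m _ *m (_ *m _)]mulmxA [(delta_mx i 0)^T *m (_ *m _)]mulmxA ee mul1mx.
    by rewrite /B -!addrA; congr (_ + (_ + _)); exact: addrC.
  apply: (IH (i |: S)); first exact: ltnW.
  - by rewrite cardsU1 iS; lia.
  - by move=> j; rewrite in_setU1 => /orP[/eqP ->|/Sg /ltnW //]; rewrite gi.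
  - move=> j l; rewrite in_setU1 negb_or => /andP[ji jS].
    by rewrite !mxE SW // big_ord1 !mxE (negbTE ji) mul0r addr0.
have none : [set root_tangent Q p.+1 (\tr (B ^+ p.+1)) *: V | V in H] (W + Z).
  apply: (IH S) => //; first exact: ltnW.
  - by rewrite (leq_trans Sk) // leq_sub2l.
  - by move=> i /Sg /ltnW.
(* Average over the outcomes of bin [n]: row [i] with probability [q i], otherwise no row. *)
have -> : W + \sum_(i | (g i < n.+1)%N) q i *: (delta_mx i 0 *m (x i)^T) =
    \sum_(i | g i == n) q i *: (W + delta_mx i 0 *m (x i)^T + Z) +
    (1 - \sum_(i | g i == n) q i) *: (W + Z).
  under [in RHS]eq_bigr do rewrite addrAC scalerDr.
  rewrite big_split /= -scaler_suml splitS addrAC -scalerDl addrC.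
  by rewrite [_ + (1 - _)]addrC subrK scale1r addrCA.
set t := fun i => \tr ((B + x i *m (x i)^T) ^+ p.+1).
(* The intermediate scale is the mean of the scales of the outcomes; affinity of the tangent and
   [trX_rank1_sampling] place it below the target. *)
apply: (@scaled_convex_le _ _ _ (\sum_(i | g i == n) q i * root_tangent Q p.+1 (t i) +
    (1 - \sum_(i | g i == n) q i) * root_tangent Q p.+1 (\tr (B ^+ p.+1)))) => //.
- apply: addr_ge0; last first.
    by rewrite mulr_ge0 ?subr_ge0 // ltW // root_tangent_gt0 // trpos.
  apply: sumr_ge0 => i _; rewrite mulr_ge0 // ltW // root_tangent_gt0 // trpos //.
  by apply: psdD => //; exact: psd_rank1.
- rewrite root_tangent_affine root_tangent_le //.
  apply: le_trans (trX_rank1_sampling _ p pBc c0 q0 xL) _.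
  by rewrite splitS scalerDr addrA addrAC.
- apply: scaled_convexD => //.
  + apply: sumr_ge0 => i _; rewrite mulr_ge0 // ltW // root_tangent_gt0 // trpos //.
    by apply: psdD => //; exact: psd_rank1.
  + by rewrite mulr_ge0 ?subr_ge0 // ltW // root_tangent_gt0 // trpos.
  + apply: scaled_convex_sum => // i gi.
      rewrite mulr_ge0 // ltW // root_tangent_gt0 // trpos //.
      by apply: psdD => //; exact: psd_rank1.
    by apply: scaled_convexZ; exact: picked.
  + exact: scaled_convexZ.
Qed.

End Sampling.

(** * Bin packing, the choice of constants and the upper inclusion *)

Section UpperBound.
Context (R : realType).

(** The mean load is at most 1/2, so some bin has load at most 1/2 and can take one more item. *)
Lemma greedy_bin_packing (I : eqType) (q : I -> R) k (s : seq I) :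
  (0 < k)%N -> uniq s -> (forall i, 0 <= q i <= 1 / 2) ->
  \sum_(i <- s) q i <= k%:R / 2 ->
  exists g : I -> 'I_k, forall t, \sum_(i <- s | g i == t) q i <= 1.
Proof.
move=> k0 + q01; elim: s => [|i s IH] /=.
  by move=> _ _; exists (fun=> Ordinal k0) => t; rewrite big_nil.
move=> /andP[iS us]; rewrite big_cons => qk.
have [qi0 qi1] : 0 <= q i /\ q i <= 1 / 2 by apply/andP.
have [|g gq] := IH us; first by lra.
have [t tq] : exists t, \sum_(j <- s | g j == t) q j <= 1 / 2.
  apply/not_existsP => h.
  have : \sum_(t < k) (1 / 2 : R) < \sum_(t < k) \sum_(j <- s | g j == t) q j.
    apply: ltr_sum => [|t _].
      by apply/hasP; exists (Ordinal k0); rewrite ?mem_index_enum.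
    by rewrite ltNge; apply/negP/h.
  have -> : \sum_(t < k) \sum_(j <- s | g j == t) q j = \sum_(j <- s) q j.
    by rewrite [RHS](partition_big g predT).
  by rewrite sumr_const card_ord -mulr_natl; lra.
exists (fun j => if j == i then t else g j) => u; rewrite big_cons eqxx.
have -> : \sum_(j <- s | (if j == i then t else g j) == u) q j =
    \sum_(j <- s | g j == u) q j.
  rewrite big_seq_cond [RHS]big_seq_cond; apply: eq_bigl => j.
  by have [->|//] := eqVneq j i; rewrite (negbTE iS).
by have [<-|_] := eqVneq t u; [lra | exact: gq].
Qed.

Lemma sampling_in_hull d r k p (q : 'I_d -> R) (x : 'I_d -> 'cV[R]_r.+1)
    (c L Q mu : R) :
  (r.+1 <= k <= d)%N -> 0 < c -> 0 < Q -> 0 <= L ->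
  (forall i, 0 <= q i <= 1 / 2) -> \sum_i q i <= k%:R / 2 ->
  (forall i, sqnorm (x i) <= L) ->
  psdmx (mu%:M - \sum_i q i *: (x i *m (x i)^T)) ->
  r.+1%:R * (c + (1 + L / c) ^+ p * mu) ^+ p.+1 <= Q ^+ p.+1 ->
  [set Num.sqrt Q *: V | V in convex_hull (@sparse_orthonormal R d r.+1 k)]
    (\sum_i q i *: (delta_mx i 0 *m (x i)^T)).
Proof.
move=> rkd c0 Q0 L0 q01 qk xL pmu rQ; set K := (1 + L / c) ^+ p in rQ.
have k0 : (0 < k)%N by case/andP: rkd => rk _; exact: leq_trans rk.
have q0 i : 0 <= q i by case/andP: (q01 i).
have [g gq] := greedy_bin_packing k0 (index_enum_uniq 'I_d) q01 qk.
have gq' t : \sum_(i | val (g i) == t) q i <= 1.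
  have [tk|kt] := ltnP t k; first exact: (gq (Ordinal tk)).
  rewrite big_pred0 // => i; apply/negbTE; rewrite neq_ltn.
  by rewrite (leq_trans (ltn_ord _) kt).
(* Initial state: nothing drawn, all [k] bins pending. *)
have := stratified_sampling p (S := finset.set0) (W := 0) (n := k)
  rkd c0 Q0 q0 xL gq' (leqnn k).
rewrite cards0 => /(_ isT) h.
have {h} : [set root_tangent Q p.+1 (\tr ((c%:M + K *:
     \sum_i q i *: (x i *m (x i)^T)) ^+ p.+1)) *: V |
     V in convex_hull (@sparse_orthonormal R d r.+1 k)]
    (\sum_i q i *: (delta_mx i 0 *m (x i)^T)).
  have := h _ _; rewrite trmx0 mul0mx addr0 add0r.
  have E (V : nmodType) (F : 'I_d -> V) :
      \sum_(i | (val (g i) < k)%N) F i = \sum_i F i.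
    by apply: eq_bigl => i; rewrite ltn_ord.
  rewrite !E; apply=> [i|i j _]; first by rewrite inE.
  by rewrite mxE.
set E := K *: _; set T := \tr _.
have K0 : 0 <= K by rewrite exprn_ge0 // addr_ge0 // divr_ge0 // ltW.
have pE : psdmx E.
  by apply: psdZ => //; apply: psd_sum => j _; apply: psdZ => //; exact: psd_rank1.
have pcE : psdmx (c%:M + E) by apply: psdD => //; exact/psd_scalar/ltW.
have T0 : 0 <= T by have := psd_trM_ge0 (psd1 R r.+1) (psdX p.+1 pcE); rewrite mul1mx.
apply: scaled_convex_le.
- exact: convex_hull_convex.
- exact: zero_in_hull.
- exact/ltW/root_tangent_gt0.
(* The trace is at most [Q ^+ p.+1], the point of tangency, where the tangent equals [sqrt Q]. *)
- rewrite -(root_tangent_Qn p.+1 Q0) root_tangent_le // (le_trans _ rQ) //.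
  have -> : r.+1%:R * (c + K * mu) ^+ p.+1 = \tr (((c + K * mu)%:M : 'M[R]_r.+1) ^+ p.+1).
    by rewrite -rmorphXn mxtrace_scalar mulr_natl.
  apply: trX_monotone => //.
  have -> : (c + K * mu)%:M - (c%:M + E) = K *: (mu%:M - \sum_i q i *: (x i *m (x i)^T)).
    by rewrite scalerBr scale_scalar_mx raddfD opprD addrACA subrr add0r.
  exact: psdZ.
Qed.

Lemma mxform_block d r (A : 'M[R]_d) (V : 'M[R]_(d, r)) (B : 'M[R]_r) x y :
  mxform (block_mx A V V^T B) (col_mx x y) (col_mx x y) =
  mxform A x x + 2 * mxform V x y + mxform B y y.
Proof.
rewrite {1}/mxform tr_col_mx mul_row_block mul_row_col !mulmxDl.
rewrite [LHS]mxE [X in X + _]mxE [X in _ + X]mxE -!/(mxform _ _ _).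
by rewrite mxformT; ring.
Qed.

Lemma row_norm2E d r (V : 'M[R]_(d, r)) i : row_norm2 V i ^+ 2 = sqnorm (row i V)^T.
Proof.
rewrite sqr_sqrtr; last by apply: sumr_ge0 => j _; exact: sqr_ge0.
by rewrite sqnormE; apply: eq_bigr => j _; rewrite !mxE.
Qed.

Lemma row_norm2_ge0 d r (V : 'M[R]_(d, r)) i : 0 <= row_norm2 V i.
Proof. exact: sqrtr_ge0. Qed.

(** With [P] the projection on the rows in [S], the block form at [(- P V y, y)] equals
    [|y|^2 - |P V y|^2]. *)
Lemma row_restriction_contraction d r (S : {set 'I_d}) (V : 'M[R]_(d, r)) :
  psdmx (block_mx 1%:M V V^T 1%:M) ->
  contraction_mx (diag_mx (\row_i (i \in S)%:R) *m V).
Proof.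
set P := diag_mx _ => pV; apply/psdP; split=> [|y].
  by rewrite linearB /= trmx1 trmx_mul trmxK.
have PT : P^T = P by rewrite tr_diag_mx.
have PP : P *m P = P.
  by apply/supported_diag => i j iS; rewrite !mxE (negbTE iS) mul0rn.
have Nl m (A : 'M[R]_(d, m)) w v : mxform A (- w) v = - mxform A w v.
  by rewrite -scaleN1r -mxformT mxformZr mxformT mulN1r.
rewrite mxformBl mxformMl; set z := P *m V *m y.
have Vz : mxform V z y = mxform (P *m V) z y.
  by rewrite -[in RHS]PT mxformMl /z !mulmxA PP.
have zz : mxform (P *m V) z y = sqnorm z by rewrite -[P *m V]mul1mx mxformM.
have := psd_ge0 (col_mx (- z) y) pV; rewrite mxform_block.
have -> : mxform 1%:M (- z) (- z) = sqnorm z.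
  by rewrite Nl -mxformT trmx1 Nl opprK.
by rewrite Nl Vz zz; lra.
Qed.

Lemma mxform_diag d (h : 'rV[R]_d) x : mxform (diag_mx h) x x = \sum_i h 0 i * x i 0 ^+ 2.
Proof.
rewrite mxformE; apply: eq_bigr => i _.
by rewrite mul_diag_mx mxE mulrCA expr2.
Qed.

Lemma mxform_outer_sum d r (q : 'I_d -> R) (x : 'I_d -> 'cV[R]_r) y :
  mxform (\sum_i q i *: (x i *m (x i)^T)) y y = \sum_i q i * mxform 1%:M (x i) y ^+ 2.
Proof. by rewrite mxform_suml; apply: eq_bigr => i _; rewrite mxformZl mxform_rank1 expr2. Qed.

(** Test the block form at [(- w / a, y)] with [w i] the inner product of [x i] and [y]: the bound
    [h <= a q] on the diagonal part uses up half of the cross term. *)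
Lemma diag_block_leverage d r (h : 'rV[R]_d) (V : 'M[R]_(d, r)) (a : R)
    (q : 'I_d -> R) (x : 'I_d -> 'cV[R]_r) :
  psdmx (block_mx (diag_mx h) V V^T 1%:M) -> 0 < a ->
  (forall i, x i = 0 \/ (h 0 i <= a * q i /\ q i *: x i = (row i V)^T)) ->
  psdmx (a%:M - \sum_i q i *: (x i *m (x i)^T)).
Proof.
move=> pV a0 hx; apply/psdP; split=> [|y].
  rewrite linearB /= tr_scalar_mx linear_sum /=; congr (_ - _); apply: eq_bigr => i _.
  by rewrite linearZ /= trmx_mul trmxK.
set w := fun i => mxform 1%:M (x i) y.
rewrite mxformBl mxform_outer_sum -[a%:M]scalemx1 mxformZl subr_ge0.
have := mulr_ge0 (ltW a0) (psd_ge0 (col_mx (\col_i (- a^-1 * w i)) y) pV).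
rewrite mxform_block mxform_diag mxformE mulr_sumr -big_split /=.
rewrite mulrDr mulr_sumr => h1.
suff h2 : \sum_(i < d) a * (h 0 i * (\col_i0 (- a^-1 * w i0)) i 0 ^+ 2 +
       2 * ((\col_i0 (- a^-1 * w i0)) i 0 * (V *m y) i 0)) <=
     \sum_i - (q i * w i ^+ 2) by rewrite sumrN in h2; lra.
apply: ler_sum => i _; rewrite !mxE.
case: (hx i) => [x0|[hq qx]].
  have -> : w i = 0 by rewrite /w x0 -mxformT /mxform mulmx0 mxE.
  by rewrite !(mulr0, mul0r, expr2, addr0, oppr0).
have -> : \sum_j V i j * y j 0 = q i * w i.
  rewrite /w -mxformT -mxformZr qx mxformT mxformE mul1mx.
  by apply: eq_bigr => j _; rewrite !mxE.
have -> : a * (h 0 i * (- a^-1 * w i) ^+ 2 + 2 * (- a^-1 * w i * (q i * w i))) =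
    h 0 i / a * w i ^+ 2 - 2 * (q i * w i ^+ 2) by field; rewrite gt_eqF.
have : h 0 i / a * w i ^+ 2 <= q i * w i ^+ 2.
  by rewrite ler_wpM2r ?sqr_ge0 // ler_pdivrMr // mulrC.
lra.
Qed.

(** Markov's inequality at threshold 1/2. *)
Lemma card_gt_half d (q : 'I_d -> R) k : (forall i, 0 <= q i) ->
  \sum_i q i <= k%:R / 2 -> (#|[set i | (1 / 2 < q i)%R]%SET| <= k)%N.
Proof.
move=> q0 qk; rewrite -(ler_nat R) -sumr_const.
suff : \sum_(i in [set i | (1 / 2 < q i)%R]%SET) (1 : R) <= 2 * \sum_i q i by lra.
rewrite mulr_sumr big_mkcond /=; apply: ler_sum => i _; rewrite inE.
by case: ltrP => [h|_]; [lra | rewrite mulr_ge0].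
Qed.

(** The choice is [c = 32 (p + 1)], [L = 16], [mu = 8], [Q = 96 (p + 1)]. Bernoulli's inequality for
    the inverse of [1 + L / c] bounds its power by 2, so the base is at most [48 (p + 1)]; the
    remaining factor 2 of [Q] absorbs [r]. *)
Lemma sampling_constants p r : (r <= 2 ^ p.+1)%N ->
  r%:R * (32 * p.+1%:R + (1 + 16 / (32 * p.+1%:R)) ^+ p * 8) ^+ p.+1 <=
  (96 * p.+1%:R) ^+ p.+1 :> R.
Proof.
move=> rp; set n : R := p.+1%:R.
have n1 : 1 <= n by rewrite ler1n.
have pn : p%:R <= n by rewrite /n ler_nat.
move: n n1 pn => n n1 pn.
set y := 1 + _.
have yE : y = 1 + 1 / (2 * n) by rewrite /y; field; rewrite gt_eqF // (lt_le_trans ltr01).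
have y1 : 1 <= y by rewrite yE lerDl divr_ge0 // mulr_ge0 // (le_trans ler01).
have y0 : 0 < y by exact: lt_le_trans y1.
have yp : y ^+ p <= 2.
  have := bernoulli_ge0 p (ltW (_ : 0 < y^-1)); rewrite invr_gt0 => /(_ y0).
  have : 1 / 2 <= 1 + p%:R * (y^-1 - 1).
    have -> : y^-1 - 1 = - (y^-1 * (1 / (2 * n))).
      have -> : 1 / (2 * n) = y - 1 by rewrite yE addrC addKr.
      by rewrite mulrBr mulr1 mulVf ?gt_eqF // opprB.
    have : p%:R * (1 / (2 * n)) <= 1 / 2.
      have n0 : 0 < 2 * n by lra.
      by rewrite mulrA mulr1 ler_pdivrMr //; lra.
    have : y^-1 <= 1 by rewrite invf_le1.
    have : 0 <= y^-1 by rewrite invr_ge0 ltW.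
    have : 0 <= p%:R * (1 / (2 * n)) by rewrite mulr_ge0 // divr_ge0 //; lra.
    nra.
  move=> h1 h2; have := le_trans h1 h2; rewrite exprVn.
  by rewrite -[1 / 2]invf_div divr1 lef_pV2 ?posrE ?exprn_gt0.
have -> : 96 * n = 2 * (48 * n) by ring.
rewrite [leRHS]exprMn; apply: ler_pM => //.
- by rewrite exprn_ge0 // addr_ge0 // mulr_ge0 // ?exprn_ge0 ?(ltW y0) //; lra.
- by rewrite -natrX ler_nat.
- rewrite ler_pXn2r ?nnegrE //; last by lra.
    by lra.
  by rewrite addr_ge0 // mulr_ge0 // ?exprn_ge0 ?(ltW y0) //; lra.
Qed.

(** The summand 1 pays for the heavy rows, the root for the sampled ones. *)
Lemma CR1'_sub_scaled_hull d r k p (V : 'M[R]_(d, r.+1)) :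
  (r.+1 <= k <= d)%N -> (r.+1 <= 2 ^ p.+1)%N -> CR1' k V ->
  [set (1 + Num.sqrt (96 * p.+1%:R)) *: U |
    U in convex_hull (@sparse_orthonormal R d r.+1 k)] V.
Proof.
move=> rkd rp [h [h0 sV sh pV pVh]].
(* Each half sums to at most [k / 4], because [pi / 2 <= 2] and [sqrt (r k) <= k]. On light rows it
   follows that [h_i <= 8 q_i] and [|V_i| <= 4 q_i]. *)
set w := fun i => h 0 i / 8 + row_norm2 V i / 4.
have w0 i : 0 <= w i by rewrite addr_ge0 // divr_ge0 // row_norm2_ge0.
have wk : \sum_i w i <= k%:R / 2.
  rewrite big_split /= -!mulr_suml.
  have : Num.sqrt (r.+1 * k)%:R <= (k%:R : R).
    rewrite -[leRHS]ger0_norm // -sqrtr_sqr ler_wsqrtr // -natrX ler_nat -mulnn.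
    by rewrite leq_mul2r; case/andP: rkd => -> _; rewrite orbT.
  have : pi / 2 * k%:R <= 2 * (k%:R : R) by rewrite ler_wpM2r // ltW // pihalf_lt2.
  lra.
set S : {set 'I_d} := [set i | (1 / 2 < w i)%R]%SET.
have Sk : (#|S| <= k)%N by exact: card_gt_half.
set P := diag_mx (\row_i (i \in S)%:R) : 'M[R]_d.
have heavy : [set 1 *: U | U in convex_hull (@sparse_orthonormal R d r.+1 k)] (P *m V).
  exists (P *m V); last by rewrite scale1r.
  apply: (sparse_contraction_in_hull (S := S)) => //.
    exact: row_restriction_contraction.
  by move=> i j iS; rewrite mul_diag_mx !mxE (negbTE iS) mul0r.
set q := fun i => if i \in S then 0 else w i.
(* Since [0^-1 = 0], [x i] is zero on heavy rows; a light row with [q i = 0] is itself zero, so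
   nothing is lost there. *)
set x := fun i => (q i)^-1 *: (row i V)^T.
have q01 i : 0 <= q i <= 1 / 2.
  rewrite /q inE; case: ltrP => [_|wi]; first by rewrite lexx divr_ge0.
  by rewrite w0.
have qk : \sum_i q i <= k%:R / 2.
  apply: le_trans wk; apply: ler_sum => i _; rewrite /q; case: ifP => // _.
have nV i : i \notin S -> row_norm2 V i <= 4 * q i.
  by move=> /negbTE iS; rewrite /q iS /w; have := h0 i; lra.
have qx i : i \notin S -> q i *: x i = (row i V)^T.
  move=> iS; rewrite /x scalerA; have [q0|q0] := eqVneq (q i) 0; last first.
    by rewrite divff // scale1r.
  rewrite q0 mul0r scale0r; apply/esym/eqP; rewrite -sqnorm_eq0 -row_norm2E.
  have := nV i iS; rewrite q0 mulr0 => n0.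
  by rewrite sqrf_eq0 eq_le n0 row_norm2_ge0.
have xL i : sqnorm (x i) <= 16.
  have [q0|q0] := eqVneq (q i) 0.
    by rewrite /x q0 invr0 scale0r (eqP (_ : sqnorm 0 == 0)) // sqnorm_eq0.
  have iS : i \notin S by apply: contra q0; rewrite /q => ->.
  have qi0 : 0 < q i by rewrite lt_neqAle eq_sym q0; case/andP: (q01 i).
  rewrite /x /sqnorm mxformZr -mxformT mxformZr trmx1 -/(sqnorm _) -row_norm2E.
  rewrite mulrA -expr2 -exprMn (_ : 16 = 4 ^+ 2); last by rewrite -natrX.
  rewrite ler_sqr ?nnegrE ?mulr_ge0 ?invr_ge0 ?(ltW qi0) ?row_norm2_ge0 //.
  by rewrite ler_pdivrMl // mulrC nV.
have p0 : 0 < 32 * p.+1%:R :> R by rewrite mulr_gt0 // ltr0n.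
have Q0 : 0 < 96 * p.+1%:R :> R by rewrite mulr_gt0 // ltr0n.
have lev : psdmx (8%:M - \sum_i q i *: (x i *m (x i)^T)).
  apply: diag_block_leverage pVh _ _ => // i; have [iS|iS] := boolP (i \in S).
    by left; rewrite /x /q iS invr0 scale0r.
  right; split; last exact: qx.
  by rewrite /q (negbTE iS) /w; have := row_norm2_ge0 V i; lra.
have := sampling_in_hull rkd p0 Q0 (ler0n R 16) q01 qk xL lev (sampling_constants rp).
move=> /(scaled_convexD (@convex_hull_convex _ _ _) ler01 (sqrtr_ge0 _) heavy).
congr image; apply/matrixP => i j; rewrite mul_diag_mx !mxE summxE.
rewrite (bigD1 i) //= big1 => [|l li]; last first.
  by rewrite !mxE big_ord1 !mxE eq_sym (negbTE li) mul0r mulr0.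
rewrite addr0 !mxE big_ord1 !mxE !eqxx mul1r.
have [iS|iS] := boolP (i \in S); first by rewrite /q iS mul0r addr0 mul1r.
by have /colP /(_ j) := qx i iS; rewrite !mxE => ->; rewrite mul0r add0r.
Qed.

End UpperBound.

(** * The relaxation *)

Section Relaxation.
Context (R : realType).

Lemma row_norm2_convex d r (V W : 'M[R]_(d, r)) (t : R) i : 0 <= t -> t <= 1 ->
  row_norm2 (t *: V + (1 - t) *: W) i <= t * row_norm2 V i + (1 - t) * row_norm2 W i.
Proof.
move=> t0 t1; have s0 : 0 <= 1 - t by lra.
have [v0 w0] := (row_norm2_ge0 V i, row_norm2_ge0 W i).
have b0 : 0 <= t * row_norm2 V i + (1 - t) * row_norm2 W i.
  by rewrite addr_ge0 ?mulr_ge0.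
rewrite -ler_sqr ?nnegrE ?row_norm2_ge0 // row_norm2E.
have -> : (row i (t *: V + (1 - t) *: W))^T = t *: (row i V)^T + (1 - t) *: (row i W)^T.
  by apply/colP => j; rewrite !mxE.
set c := mxform 1%:M (row i V)^T (row i W)^T.
have cle : c <= row_norm2 V i * row_norm2 W i.
  apply: le_trans (ler_norm c) _.
  rewrite -ler_sqr ?nnegrE ?mulr_ge0 // real_normK ?num_real // exprMn !row_norm2E.
  exact/psd_CS/psd1.
rewrite /sqnorm mxformDr !mxformZr ![mxform _ (_ + _) _](psd_formC _ _ (psd1 R r)).
rewrite !mxformDr !mxformZr [mxform _ (row i W)^T (row i V)^T](psd_formC _ _ (psd1 R r)).
rewrite -/c -!/(sqnorm _) -!row_norm2E.
have := ler_wpM2l (mulr_ge0 t0 s0) cle; lra.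
Qed.

(** The block matrix is the Gram matrix of [row_mx P V]. *)
Lemma projection_block_psd d r (P : 'M[R]_d) (V : 'M[R]_(d, r)) :
  P^T = P -> P *m P = P -> P *m V = V -> V^T *m V = 1%:M ->
  psdmx (block_mx P V V^T 1%:M).
Proof.
move=> PT PP PV VV; have VP : V^T *m P = V^T by rewrite -[V in RHS]PV trmx_mul PT.
by have := psd_gram (row_mx P V); rewrite tr_row_mx mul_col_row PT PP PV VV VP.
Qed.

Lemma sparse_orthonormal_sub_CR1' d r k :
  @sparse_orthonormal R d r k `<=` @CR1' R d r k.
Proof.
move=> V [VV Vk]; set S : {set 'I_d} := [set i | row i V != 0]%SET.
set P := diag_mx (\row_i (i \in S)%:R) : 'M[R]_d.
have SV : supported_on S V.
  by move=> i j; rewrite inE negbK => /eqP /rowP /(_ j); rewrite !mxE.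
have Sk : (#|S| <= k)%N.
  by apply: leq_trans Vk; rewrite subset_leq_card //; apply/fintype.subsetP => i; rewrite !inE.
have cS : \sum_(i < d) (i \in S)%:R = #|S|%:R :> R.
  rewrite -sumr_const [RHS]big_mkcond /=; apply: eq_bigr => i _.
  by case: (i \in S).
(* The witness is the indicator of the support: [diag h] is then a projection that fixes [V]. *)
exists (\row_i (i \in S)%:R); split.
- by move=> i; rewrite mxE ler0n.
- rewrite -[leLHS]ger0_norm ?sumr_ge0 // => [|i _]; last exact: row_norm2_ge0.
  rewrite -sqrtr_sqr ler_wsqrtr //.
  (* Cauchy-Schwarz against the indicator of the support, with [|u|^2 = |S|] and
     [|v|^2 = tr (V^T V) = r]. *)
  set u : 'cV[R]_d := \col_i (i \in S)%:R; set v : 'cV[R]_d := \col_i row_norm2 V i.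
  have -> : \sum_(i < d) row_norm2 V i = mxform 1%:M u v.
    rewrite mxformE mul1mx; apply: eq_bigr => i _; rewrite !mxE.
    have [|iS] := boolP (i \in S); first by rewrite mul1r.
    rewrite mul0r; apply/eqP; rewrite -sqrf_eq0 row_norm2E sqnorm_eq0.
    by move: iS; rewrite inE negbK => /eqP ->; rewrite trmx0.
  apply: le_trans (psd_CS u v (psd1 R d)) _; rewrite -!/(sqnorm _).
  have -> : sqnorm u = #|S|%:R.
    rewrite sqnormE -cS; apply: eq_bigr => i _; rewrite mxE.
    by case: (i \in S); rewrite ?expr1n ?expr0n.
  have -> : sqnorm v = r%:R.
    rewrite sqnormE -(mxtrace1 R r) -VV /mxtrace.
    under [RHS]eq_bigr do rewrite mxE.
    rewrite exchange_big /=; apply: eq_bigr => i _; rewrite mxE row_norm2E sqnormE.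
    by apply: eq_bigr => j _; rewrite !mxE expr2.
  by rewrite -natrM ler_nat mulnC leq_mul2l Sk orbT.
- under eq_bigr do rewrite mxE.
  rewrite cS; apply: (@le_trans _ _ (1 * k%:R)); first by rewrite mul1r ler_nat.
  by rewrite ler_wpM2r // pihalf_ge1.
- by apply: projection_block_psd; rewrite ?trmx1 ?mul1mx.
- apply: projection_block_psd => //; first by rewrite tr_diag_mx.
    by apply/supported_diag => i j iS; rewrite !mxE (negbTE iS) mul0rn.
  exact/supported_diag.
Qed.

Lemma psd_block_convex d r (A A' : 'M[R]_d) (V V' : 'M[R]_(d, r)) (t : R) :
  0 <= t -> t <= 1 -> psdmx (block_mx A V V^T 1%:M) -> psdmx (block_mx A' V' V'^T 1%:M) ->
  psdmx (block_mx (t *: A + (1 - t) *: A') (t *: V + (1 - t) *: V')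
    (t *: V + (1 - t) *: V')^T 1%:M).
Proof.
move=> t0 t1 pV pV'; have s0 : 0 <= 1 - t by lra.
have := psdD (psdZ t0 pV) (psdZ s0 pV').
rewrite !scale_block_mx add_block_mx -scalerDl [t + _]addrC subrK scale1r.
by rewrite linearD /= !linearZ.
Qed.

Lemma CR1'_convex d r k : @convex_set R _ (@CR1' R d r k).
Proof.
apply/convex_setP => t V W t0 t1 [h [h0 hV hk pV pVh]] [g [g0 gW gk pW pWg]].
have s0 : 0 <= 1 - t by lra.
exists (t *: h + (1 - t) *: g); split.
- by move=> i; rewrite !mxE addr_ge0 ?mulr_ge0.
- apply: le_trans (ler_sum _ (fun i _ => row_norm2_convex V W i t0 t1)) _.
  rewrite big_split /= -!mulr_sumr.
  have := ler_wpM2l t0 hV; have := ler_wpM2l s0 gW; lra.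
- under eq_bigr do rewrite !mxE.
  rewrite big_split /= -!mulr_sumr.
  have := ler_wpM2l t0 hk; have := ler_wpM2l s0 gk; lra.
- have := psd_block_convex t0 t1 pV pW.
  by rewrite -scalerDl [t + _]addrC subrK scale1r.
- have := psd_block_convex t0 t1 pVh pWg.
  suff -> : diag_mx (t *: h + (1 - t) *: g) = t *: diag_mx h + (1 - t) *: diag_mx g by [].
  by rewrite linearD /= !linearZ.
Qed.

(** * Size and growth of the approximation factor *)

Lemma ln2_gt0 : 0 < ln (2 : R).
Proof. by rewrite ln_gt0 // ltr1n. Qed.

(** Follows from [96 <= 12 ^ 2], [n <= log2 (50 r)] and [pi / 2 >= 1]. *)
Lemma rho_CR1'_lower r n : (0 < n)%N -> (2 ^ n <= 50 * r)%N ->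
  1 + Num.sqrt (96 * n%:R) <= rho_CR1' R r.
Proof.
move=> n0 nr; set s := Num.sqrt (n%:R : R).
have s0 : 0 <= s by exact: sqrtr_ge0.
have log_ge : n%:R <= log2 (50 * r%:R : R).
  rewrite /log2 ler_pdivlMr ?ln2_gt0 // [n%:R * _]mulr_natl -lnXn // -natrX -natrM.
  have : (0 < 50 * r)%N by apply: leq_trans nr; rewrite expn_gt0.
  by move=> r0; rewrite ler_ln ?posrE ?ltr0n ?expn_gt0 // ler_nat.
have sE : Num.sqrt (96 * n%:R : R) <= 12 * s.
  rewrite (_ : 12 * s = Num.sqrt (144 * n%:R)).
    by rewrite ler_wsqrtr // ler_wpM2r // ler_nat.
  have -> : 144 = 12 ^+ 2 :> R by rewrite -natrX.
  by rewrite sqrtrM ?sqr_ge0 // sqrtr_sqr ger0_norm.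
have sl : s <= Num.sqrt (log2 (50 * r%:R)) by rewrite ler_wsqrtr.
have pi1 : 1 <= Num.sqrt (pi / 2 : R).
  by rewrite -[leLHS]sqrtr1 ler_wsqrtr // pihalf_ge1.
rewrite /rho_CR1'; set m := Num.max _ _.
have : 12 * Num.sqrt (log2 (50 * r%:R)) <= m by rewrite le_max lexx orbT.
nra.
Qed.

Lemma rho_CR1'_bigO :
  (fun r : nat => rho_CR1' R r : R^o) =O_\oo
    (fun r : nat => Num.sqrt (ln (r%:R : R)) : R^o).
Proof.
have l0 := ln2_gt0; set l := ln (2 : R) in l0.
set a := Num.sqrt l; have a0 : 0 < a by rewrite sqrtr_gt0.
set P := Num.sqrt (pi / 2 : R); set M := 6 * Num.sqrt (2 * pi : R).
have P0 : 0 <= P by exact: sqrtr_ge0.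
have M0 : 0 <= M by rewrite mulr_ge0 // sqrtr_ge0.
set b := Num.sqrt (2 / l); have b0 : 0 <= b by exact: sqrtr_ge0.
apply/eqO_exP; exists (1 + P * ((2 + M) / a + 12 * b)).
  rewrite ltr_pwDl // mulr_ge0 // addr_ge0 ?mulr_ge0 ?invr_ge0 ?(ltW a0) //.
  by rewrite addr_ge0.
(* From [r = 50] on, [50 r <= r ^ 2], hence [log2 (50 r) <= 2 log2 r]; also [ln r >= ln 2], so
   constants are multiples of [s]. *)
exists 50%N => // r /= r50.
have r0 : (0 < r%:R :> R) by rewrite ltr0n; exact: leq_trans r50.
have lnr : l <= ln (r%:R : R).
  by rewrite ler_ln ?posrE // ler_nat; exact: leq_trans r50.
set s := Num.sqrt (ln r%:R); have s0 : 0 <= s by exact: sqrtr_ge0.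
have a_le_s : a <= s by rewrite ler_wsqrtr.
have logr : Num.sqrt (log2 (50 * r%:R)) <= b * s.
  rewrite -sqrtrM; last by rewrite divr_ge0 // ltW.
  rewrite ler_wsqrtr // /log2 mulrAC ler_pM2r ?invr_gt0 //.
  rewrite [2 * _]mulr_natl -lnXn // ler_ln ?posrE ?exprn_gt0 ?mulr_gt0 //.
  by rewrite expr2 ler_pM2r // ler_nat.
rewrite !ger0_norm //; last first.
  by rewrite mulr_ge0 // addr_ge0 // le_max M0.
rewrite /rho_CR1' -/P -/M.
have : Num.max M (12 * Num.sqrt (log2 (50 * r%:R))) <= M / a * s + 12 * (b * s).
  rewrite ge_max; apply/andP; split.
    rewrite ler_wpDr ?mulr_ge0 // -mulrA ler_peMr // ler_pdivlMl //; lra.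
  by rewrite ler_wpDl ?mulr_ge0 ?invr_ge0 ?(ltW a0) // ler_wpM2l.
set m := Num.max _ _ => mle.
have h2 : 2 <= 2 / a * s by rewrite -mulrA ler_peMr // ler_pdivlMl //; lra.
apply: le_trans (_ : P * ((2 / a * s) + (M / a * s + 12 * (b * s))) <= _).
  by rewrite ler_wpM2l // lerD.
have -> : P * (2 / a * s + (M / a * s + 12 * (b * s))) =
  P * ((2 + M) / a + 12 * b) * s by ring.
by rewrite ler_wpM2r // lerDr.
Qed.

End Relaxation.

Theorem theorem2 (R : realType) :
  (forall d r k : nat, (1 <= r)%N -> (r <= k)%N -> (k <= d)%N ->
     convex_hull (@sparse_orthonormal R d r k) `<=` @CR1' R d r k /\
     @CR1' R d r k `<=`
       [set rho_CR1' R r *: V | V in convex_hull (@sparse_orthonormal R d r k)])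
  /\
  (fun r : nat => rho_CR1' R r : R^o) =O_\oo
    (fun r : nat => Num.sqrt (ln (r%:R : R)) : R^o).
Proof.
split; last exact: rho_CR1'_bigO.
move=> d [//|r] k _ rk kd; split.
  by apply: smallest_sub; [exact: CR1'_convex|exact: sparse_orthonormal_sub_CR1'].
move=> V CV; have rkd : (r.+1 <= k <= d)%N by rewrite rk kd.
(* [2 ^ p.+1] is the least power of 2 above the number of columns; it is at most twice that number,
   well below the factor 50 allowed. *)
set p := trunc_log 2 r.+1.
have rp : (r.+1 <= 2 ^ p.+1)%N by apply: ltnW; exact: trunc_log_ltn.
apply: scaled_convex_le (CR1'_sub_scaled_hull rkd rp CV).
- exact: convex_hull_convex.
- exact: zero_in_hull.
- by rewrite addr_ge0 // sqrtr_ge0.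
- apply: rho_CR1'_lower => //; have := @trunc_logP 2 r.+1 isT isT.
  by rewrite -/p expnS; lia.
Qed.
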